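(* Consider the MS-P-IMPES scheme described in the context. Let $n\ge 0$ and suppose that $S_\alpha^{H,n}\in(0,1)$ on every fine element, for $\alpha=w,n$, with tolerance saturations $S_{t\alpha}$ satisfying $S_\alpha^{H,n}\ge S_{t\alpha}>0$, $\alpha=w,n$. Let $\Delta t=t_{n+1}-t_n$. Then, if $\Delta t/h$ is small enough (i.e. there is $\varepsilon>0$, depending on the data and on the discrete solution at time level $n$, such that the following holds whenever $\Delta t/h\le\varepsilon$), for every $K^h\in\mathcal T_h$, $$S_\alpha^{H,n+1}|_{K^h}\in(0,1),\qquad \alpha=w,n .$$
   Context: Setting: incompressible immiscible two-phase flow in a porous domain $\Omega$ (a rectangle in $\mathbb R^2$), with phases $\alpha=w$ (wetting) and $\alpha=n$ (non-wetting), constant porosity $\zeta>0$, absolute permeability $\mathbf K$, phase mobilities $\lambda_\alpha=k_{r\alpha}/\mu_\alpha$ (functions of $S_w$), $\lambda_t=\lambda_w+\lambda_n$, fractional flows $f_\alpha=\lambda_\alpha/\lambda_t$ (functions of $S_w$), sources $q_\alpha$, $q_t=q_w+q_n$, capillary pressure function $p_c$, densities $\rho_\alpha$, gravity magnitude $g$, depth $z$, boundary pressures $p_\alpha^B$ on $\Gamma_D\subset\partial\Omega$. $(\cdot,\cdot)$ is the $L^2(\Omega)$ inner product. Properties of the data taken as known: there are constants $l_\alpha>0$ such that $f_\alpha\le l_\alpha S_\alpha$ (with $f_\alpha$ regarded as a function of $S_\alpha$), and wherever $q_\alpha\le 0$ (sink) there are constants $l_1,l_2>0$ with $l_1S_\alpha\le|q_\alpha|\le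 l_2S_\alpha$. Meshes and spaces: $\mathcal T_H$ is a coarse mesh of squares of side $H$; each coarse element is subdivided into squares of side $h$, giving the fine mesh $\mathcal T_h$. $V_h$ is the lowest order Raviart–Thomas space on $\mathcal T_h$; $Q_h$ and $Q_H$ are the spaces of piecewise constants on $\mathcal T_h$ and $\mathcal T_H$. $V_{\mathrm{ms}}\subset V_h$ is the multiscale velocity space of the mixed generalized multiscale finite element method: it is spanned by functions, each supported on the union $D_i=K_{i,1}\cup K_{i,2}$ of the two coarse elements sharing an interior coarse edge $E_i$, which in each of $K_{i,1},K_{i,2}$ are RT0 mixed solutions $\psi$ of $\kappa_0^{-1}\psi+\nabla p=0$, $\nabla\cdot\psi=$ const, with $\psi\cdot\mathbf n=0$ on $\partial D_i$ and prescribed normal component on $E_i$, where $\kappa_0=\lambda_t(S_w^0)\mathbf K$. Upwinding: for $S_\alpha^{H,n}\in Q_h$ and an edge $e\subset\partial K^h$ shared with the neighbour $K^{h,1}$, with $\mathbf n$ outward to $K^h$, set $S_\alpha^{*,H,n}|_e=S_\alpha^{H,n}|_{K^h}$ if $\{\mathbf u_\alpha^{H,n}\cdot\mathbf n\}_e\ge0$ and $S_\alpha^{*,H,n}|_e=S_\alpha^{H,n}|_{K^{h,1}}$ otherwise ($\{\cdot\}_e$ is the average across $e$); on boundary edges the value from $K^h$ is used. Here $\mathbf u_w^{H,n+1}=f_w(S_w^{H,n})\mathbf u_t^{H,n+1}-f_wf_n(S_w^{H,n})\xi_c^{H,n+1}$, $\mathbf u_n^{H,n+1}=f_n(S_w^{H,n})\mathbf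 u_t^{H,n+1}+f_wf_n(S_w^{H,n})\xi_c^{H,n+1}$ (and $\mathbf u_\alpha^{H,0}$ are given initial velocities). Put $S_{w,w}^{*,H,n}=S_w^{*,H,n}$, $S_{w,n}^{*,H,n}=1-S_n^{*,H,n}$. For $q\in Q_h$, $$\beta_\alpha(\mathbf v,q;S_w^{H,n})=\sum_{K^h\in\mathcal T_h}\int_{\partial K^h}f_\alpha(S_{w,\alpha}^{*,H,n})\,\mathbf v\cdot\mathbf n\,q,\qquad \beta_c(\mathbf v,q;S_w^{H,n})=\sum_{K^h\in\mathcal T_h}\int_{\partial K^h}f_w(S_{w,w}^{*,H,n})f_n(S_{w,n}^{*,H,n})\,\mathbf v\cdot\mathbf n\,q .$$ MS-P-IMPES scheme (initial data with $S_w^{H,0}+S_n^{H,0}=1$). With $\kappa_n^H=\lambda_t(S_w^{H,n})\mathbf K$ and $\tilde p_c(S_w^{H,n})\in Q_H$ the average of $p_c(S_w^{H,n})$ over each coarse element: (1) find $\xi_c^{H,n+1}\in V_{\mathrm{ms}}$ with $((\kappa_n^H)^{-1}\xi_c^{H,n+1},\mathbf v)=(\tilde p_c(S_w^{H,n}),\nabla\cdot\mathbf v)-\int_{\Gamma_D}(p_n^B-p_w^B)\mathbf v\cdot\mathbf n-((\rho_n-\rho_w)g\nabla z,\mathbf v)$ for all $\mathbf v\in V_{\mathrm{ms}}$; (2) find $\mathbf u_t^{H,n+1}\in V_{\mathrm{ms}}$, $p_w^{H,n+1}\in Q_H$ with $((\kappa_n^H)^{-1}\mathbf u_t^{H,n+1},\mathbf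 v)-(p_w^{H,n+1},\nabla\cdot\mathbf v)=((\kappa_n^H)^{-1}f_n(S_w^{H,n})\xi_c^{H,n+1},\mathbf v)-\int_{\Gamma_D}p_w^B\mathbf v\cdot\mathbf n-(\rho_wg\nabla z,\mathbf v)$ for all $\mathbf v\in V_{\mathrm{ms}}$ and $\sum_\alpha\beta_\alpha(\mathbf u_t^{H,n+1},q;S_w^{H,n})=(q_t,q)$ for all $q\in Q_H$; then postprocess $\mathbf u_t^{H,n+1}$ locally on the fine grid in every coarse element on which $q_t$ is not constant, keeping the normal component on the coarse element boundary, so that the postprocessed velocity in $V_h$ (still denoted $\mathbf u_t^{H,n+1}$) satisfies $\sum_{\alpha}\beta_\alpha(\mathbf u_t^{H,n+1},q;S_w^{H,n})=(q_t,q)$ for all $q\in Q_h$; (3) find $S_w^{H,n+1}\in Q_h$ with $\big(\zeta\frac{S_w^{H,n+1}-S_w^{H,n}}{\Delta t},q\big)+\beta_w(\mathbf u_t^{H,n+1},q;S_w^{H,n})=(q_w,q)+\beta_c(\xi_c^{H,n+1},q;S_w^{H,n})$ for all $q\in Q_h$, and set $S_n^{H,n+1}=1-S_w^{H,n+1}$. *)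

(* Defs.v *)
From HB Require Import structures.
From mathcomp Require Import all_boot all_order all_algebra.
From mathcomp Require Import all_classical all_reals all_analysis.

Set Implicit Arguments.
Unset Strict Implicit.
Unset Printing Implicit Defensive.

Import Order.TTheory GRing.Theory Num.Theory.
Import numFieldNormedType.Exports.

Local Open Scope classical_set_scope.
Local Open Scope ring_scope.

(* The rectangle is cut into [ncx * ncy] coarse squares of side [H = ndiv * h],
   each of them into [ndiv * ndiv] fine squares of side [h]. *)
Record mesh (R : realType) := Mesh {
  corner : R * R;
  ncx : nat;
  ncy : nat;
  ndiv : nat;
  hfine : R;
  ncx_gt0 : (0 < ncx)%N;
  ncy_gt0 : (0 < ncy)%N;
  ndiv_gt0 : (0 < ndiv)%N;
  hfine_gt0 : 0 < hfine
}.

Definition Hcoarse (R : realType) (M : mesh R) : R := (ndiv M)%:R * hfine M.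

Definition cell (R : realType) (M : mesh R) : finType :=
  ('I_(ncx M * ndiv M) * 'I_(ncy M * ndiv M))%type.

Definition ccell (R : realType) (M : mesh R) : finType :=
  ('I_(ncx M) * 'I_(ncy M))%type.

Lemma coarse_subproof (N m : nat) (m_gt0 : (0 < m)%N) (i : 'I_(N * m)) :
  (i %/ m < N)%N.
Proof. by rewrite ltn_divLR. Qed.

Definition coarse (R : realType) (M : mesh R) (K : cell M) : ccell M :=
  (Ordinal (coarse_subproof (ndiv_gt0 M) K.1),
   Ordinal (coarse_subproof (ndiv_gt0 M) K.2)).

(* The face [(d, s)] of a square has its normal along coordinate axis [d]; it is
   the face on the increasing ([s = true]) or decreasing ([s = false]) side. *)
Definition face : finType := ('I_2 * bool)%type.

Definition shift_ord (n : nat) (s : bool) (i : 'I_n) : option 'I_n :=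
  if s then insub i.+1 else if i == 0 :> nat then None else insub i.-1.

(* [None] when the face lies on the boundary of the rectangle. *)
Definition nbr (nx ny : nat) (K : 'I_nx * 'I_ny) (F : face) :
    option ('I_nx * 'I_ny) :=
  if F.1 == 0 then omap (fun i => (i, K.2)) (shift_ord F.2 K.1)
  else omap (fun j => (K.1, j)) (shift_ord F.2 K.2).

Definition xcoord (R : realType) (x : R * R) (d : 'I_2) : R :=
  if d == 0 then x.1 else x.2.

Definition cidx (R : realType) (M : mesh R) (K : cell M) (d : 'I_2) : nat :=
  if d == 0 then K.1 : nat else K.2 : nat.

Definition cellset (R : realType) (M : mesh R) (K : cell M) : set (R * R) :=
  [set x | forall d : 'I_2,
     xcoord (corner M) d + (cidx K d)%:R * hfine M <= xcoord x d
       <= xcoord (corner M) d + (cidx K d).+1%:R * hfine M].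

Definition Omega (R : realType) (M : mesh R) : set (R * R) :=
  [set x | (corner M).1 <= x.1 <= (corner M).1 + (ncx M)%:R * Hcoarse M /\
           (corner M).2 <= x.2 <= (corner M).2 + (ncy M)%:R * Hcoarse M].

Definition bdOmega (R : realType) (M : mesh R) : set (R * R) :=
  Omega M `\` (Omega M)°.

(* Arc-length parametrization, for [0 <= t <= h], of the face [F] of [K]. *)
Definition facept (R : realType) (M : mesh R) (K : cell M) (F : face) (t : R) :
    R * R :=
  let c d := xcoord (corner M) d + (cidx K d)%:R * hfine M
             + (if d == F.1 then F.2%:R * hfine M else t) in
  (c 0, c 1).

Definition facemid (R : realType) (M : mesh R) (K : cell M) (F : face) : R * R :=
  facept K F (hfine M / 2).

Definition normal (R : realType) (F : face) : 'cV[R]_2 :=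
  (if F.2 then 1 else -1) *: delta_mx F.1 0.

Definition dot (R : realType) (u v : 'cV[R]_2) : R := \sum_k u k 0 * v k 0.

Definition leb2 (R : realType) :
    {measure set (measurableTypeR R * measurableTypeR R)%type -> \bar R} :=
  (@lebesgue_measure R \x @lebesgue_measure R)%E.
Arguments leb2 R : clear implicits.

(* Integral over the rectangle of a function given separately on each cell. *)
Definition omega_int (R : realType) (M : mesh R) (g : cell M -> R * R -> R) : R :=
  \sum_(K : cell M) \int[leb2 R]_(x in cellset K) g K x.

Definition face_int (R : realType) (M : mesh R) (K : cell M) (F : face)
    (g : R * R -> R) : R :=
  \int[@lebesgue_measure R]_(t in `[0, hfine M]) g (facept K F t).

Definition bd_face_int (R : realType) (M : mesh R) (G : set (R * R))
    (g : cell M -> face -> R * R -> R) : R :=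
  \sum_(K : cell M) \sum_(F : face | nbr K F == None)
    \int[@lebesgue_measure R]_(t in `[0, hfine M] `&` [set t | G (facept K F t)])
      g K F (facept K F t).

Definition Qh (R : realType) (M : mesh R) := {ffun cell M -> R}.

Definition in_QH (R : realType) (M : mesh R) (q : Qh M) : Prop :=
  forall K K' : cell M, coarse K = coarse K' -> q K = q K'.

(* Cellwise lowest order Raviart-Thomas fields, without continuity: the matrix
   [P] attached to a cell stands for the field
   [x |-> (P 0 0 + P 0 1 * x.1, P 1 0 + P 1 1 * x.2)]. *)
Definition bRT (R : realType) (M : mesh R) := {ffun cell M -> 'M[R]_2}.

Definition rtval (R : realType) (P : 'M[R]_2) (x : R * R) : 'cV[R]_2 :=
  \col_k (P k 0 + P k 1 * xcoord x k).

Definition rtdiv (R : realType) (P : 'M[R]_2) : R := P 0 1 + P 1 1.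

(* On a face the normal component of such a field is constant, so its value at
   the midpoint determines it. *)
Definition nflux (R : realType) (M : mesh R) (u : bRT M) (K : cell M)
    (F : face) : R :=
  dot (rtval (u K) (facemid K F)) (normal R F).

(* The average across the face of [u . n], [n] outward to [K]. *)
Definition avg_nflux (R : realType) (M : mesh R) (u : bRT M) (K : cell M)
    (F : face) : R :=
  if nbr K F is Some K' then
    (dot (rtval (u K) (facemid K F)) (normal R F)
     + dot (rtval (u K') (facemid K F)) (normal R F)) / 2
  else nflux u K F.

Definition in_Vh (R : realType) (M : mesh R) (v : bRT M) : Prop :=
  forall (K K' : cell M) (F : face), nbr K F = Some K' ->
    dot (rtval (v K) (facemid K F)) (normal R F)
    = dot (rtval (v K') (facemid K F)) (normal R F).

Definition cscale (R : realType) (M : mesh R) (c : cell M -> R) (u : bRT M) :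
    bRT M := [ffun K => c K *: u K].

Inductive phase := Wet | NonWet.

Record model (R : realType) := Model {
  poro : R;
  perm : R * R -> 'M[R]_2;
  visc : phase -> R;
  krel : phase -> R -> R;
  pcap : R -> R;
  dens : phase -> R;
  grav : R;
  depth : R * R -> R;
  pbdry : phase -> R * R -> R;
  GammaD : set (R * R);
  src : phase -> R -> R * R -> R     (* [src a s x] is q_a at x when S_a(x) = s *)
}.

(* Mobilities and fractional flows are functions of the wetting saturation. *)
Definition mob (R : realType) (D : model R) (a : phase) (s : R) : R :=
  krel D a s / visc D a.

Definition mobt (R : realType) (D : model R) (s : R) : R :=
  mob D Wet s + mob D NonWet s.

Definition frac (R : realType) (D : model R) (a : phase) (s : R) : R :=
  mob D a s / mobt D s.

Definition Sw_of (R : realType) (a : phase) (s : R) : R :=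
  if a is Wet then s else 1 - s.

Definition grad_depth (R : realType) (D : model R) (x : R * R) : 'cV[R]_2 :=
  \col_k (if k == 0 then derive1 (fun s : R => depth D (s, x.2)) x.1
          else derive1 (fun s : R => depth D (x.1, s)) x.2).

(* Nothing is asked of a source at points where it vanishes: the two-sided bound
   concerns genuine sinks. *)
Record admissible (R : realType) (M : mesh R) (D : model R) : Prop := Admissible {
  poro_gt0 : 0 < poro D;
  perm_sym : forall x, Omega M x -> (perm D x)^T = perm D x;
  perm_elliptic : exists kmin kmax : R, 0 < kmin /\
    forall x, Omega M x -> forall v : 'cV[R]_2,
      kmin * dot v v <= dot (perm D x *m v) v <= kmax * dot v v;
  perm_meas : forall i j : 'I_2,
    measurable_fun (Omega M : set (measurableTypeR R * measurableTypeR R))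
      (fun x => perm D x i j);
  visc_gt0 : forall a, 0 < visc D a;
  krel_ge0 : forall a s, 0 <= s <= 1 -> 0 <= krel D a s;
  mobt_gt0 : forall s, 0 <= s <= 1 -> 0 < mobt D s;
  dens_gt0 : forall a, 0 < dens D a;
  grav_ge0 : 0 <= grav D;
  depth_diff : forall x, Omega M x -> differentiable (depth D) x;
  depth_cont : forall i : 'I_2,
    {within Omega M, continuous (fun x => grad_depth D x i 0)};
  GammaD_bd : GammaD D `<=` bdOmega M;
  GammaD_meas : forall (K : cell M) (F : face), nbr K F = None ->
    measurable (`[0, hfine M]%classic `&` [set t | GammaD D (facept K F t)]
                : set (measurableTypeR R));
  pbdry_int : forall a (K : cell M) (F : face), nbr K F = None ->
    (@lebesgue_measure R).-integrable
      (`[0, hfine M]%classic `&` [set t | GammaD D (facept K F t)])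
      (fun t => (pbdry D a (facept K F t))%:E);
  src_int : forall a s, 0 <= s <= 1 ->
    (leb2 R).-integrable (Omega M) (fun x => (src D a s x)%:E);
  frac_le : forall a, exists2 l : R, 0 < l &
    forall s, 0 <= s <= 1 -> frac D a (Sw_of a s) <= l * s;
  sink_bound : forall a, exists l1 l2 : R, [/\ 0 < l1, 0 < l2 &
    forall s x, 0 <= s <= 1 -> Omega M x -> src D a s x < 0 ->
      l1 * s <= `|src D a s x| <= l2 * s]
}.

(* ((lambda_t(S) K)^-1 u, v) *)
Definition kinv_form (R : realType) (M : mesh R) (D : model R) (S : Qh M)
    (u v : bRT M) : R :=
  omega_int (fun (K : cell M) x =>
    dot (invmx (mobt D (S K) *: perm D x) *m rtval (u K) x) (rtval (v K) x)).

Definition div_form (R : realType) (M : mesh R) (p : Qh M) (v : bRT M) : R :=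
  omega_int (fun (K : cell M) _ => p K * rtdiv (v K)).

(* [C] and [C'] are the coarse elements sharing the interior coarse edge;
   [mu] prescribes the component of [psi] along the normal to that edge that is
   outward to [C], on the fine faces of the edge (indexed by their cells in [C]).
   In each of the two elements, [psi] solves the mixed problem weakly, against
   fields of V_h living in that element with no flux through its boundary. *)
Definition ms_basis (R : realType) (M : mesh R) (D : model R) (S0 : Qh M)
    (C C' : ccell M) (G : face) (mu : cell M -> R) (psi : bRT M) : Prop :=
  [/\ nbr C G = Some C',
      in_Vh psi,
      (forall K, coarse K != C -> coarse K != C' -> psi K = 0),
      (forall K F, (coarse K == C) || (coarse K == C') ->
         (if nbr K F is Some K' then (coarse K' != C) && (coarse K' != C')
          else true) -> nflux psi K F = 0) &
      (forall K K', nbr K G = Some K' -> coarse K = C -> coarse K' = C' ->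
         nflux psi K G = mu K) /\
      (forall L, L \in [:: C; C'] ->
         (exists c : R, forall K, coarse K = L -> rtdiv (psi K) = c) /\
         (exists p : Qh M, forall v : bRT M, in_Vh v ->
            (forall K, coarse K != L -> v K = 0) ->
            (forall K F, coarse K = L -> nbr K F = None -> nflux v K F = 0) ->
            kinv_form D S0 psi v - div_form p v = 0))].

Definition is_ms_space (R : realType) (M : mesh R) (D : model R) (S0 : Qh M)
    (V : {vspace bRT M}) : Prop :=
  exists2 B : seq (bRT M), V = <<B>>%VS &
    forall psi, psi \in B ->
      exists C C' G mu, ms_basis D S0 C C' G mu psi.

(* Discrete solution at one time level; [vel a] is the phase velocity used for
   upwinding. *)
Record level (R : realType) (M : mesh R) := Level {
  sat : phase -> Qh M;
  vel : phase -> bRT M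
}.

(* The upwind value of S_a on the face [F] of [K]. *)
Definition upwind (R : realType) (M : mesh R) (L : level M) (a : phase)
    (K : cell M) (F : face) : R :=
  if nbr K F is Some K' then
    if 0 <= avg_nflux (vel L a) K F then sat L a K else sat L a K'
  else sat L a K.

(* The wetting saturation S_{w,a}^* deduced from the upwind value of S_a. *)
Definition Swup (R : realType) (M : mesh R) (L : level M) (a : phase)
    (K : cell M) (F : face) : R :=
  Sw_of a (upwind L a K F).

Definition beta (R : realType) (M : mesh R) (D : model R) (L : level M)
    (a : phase) (v : bRT M) (q : Qh M) : R :=
  \sum_(K : cell M) \sum_(F : face) face_int K F (fun x =>
    frac D a (Swup L a K F) * dot (rtval (v K) x) (normal R F) * q K).

Definition betac (R : realType) (M : mesh R) (D : model R) (L : level M)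
    (v : bRT M) (q : Qh M) : R :=
  \sum_(K : cell M) \sum_(F : face) face_int K F (fun x =>
    frac D Wet (Swup L Wet K F) * frac D NonWet (Swup L NonWet K F)
      * dot (rtval (v K) x) (normal R F) * q K).

Definition srcf (R : realType) (M : mesh R) (D : model R) (L : level M)
    (a : phase) (K : cell M) (x : R * R) : R :=
  src D a (sat L a K) x.

Definition srct (R : realType) (M : mesh R) (D : model R) (L : level M)
    (K : cell M) (x : R * R) : R :=
  srcf D L Wet K x + srcf D L NonWet K x.

Definition pcavg (R : realType) (M : mesh R) (D : model R) (S : Qh M) : Qh M :=
  [ffun K => (\sum_(K' : cell M | coarse K' == coarse K)
                \int[leb2 R]_(x in cellset K') pcap D (S K')) / Hcoarse M ^+ 2].

Definition grav_form (R : realType) (M : mesh R) (D : model R) (r : R)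
    (v : bRT M) : R :=
  omega_int (fun (K : cell M) x =>
    dot ((r * grav D) *: grad_depth D x) (rtval (v K) x)).

Definition bdry_form (R : realType) (M : mesh R) (D : model R)
    (p : R * R -> R) (v : bRT M) : R :=
  bd_face_int (GammaD D) (fun (K : cell M) F x =>
    p x * dot (rtval (v K) x) (normal R F)).

(* [vp_ums] is the multiscale total velocity and [vp_ut] the postprocessed one. *)
Record velpres (R : realType) (M : mesh R) := VelPres {
  vp_xi : bRT M;
  vp_pw : Qh M;
  vp_ums : bRT M;
  vp_ut : bRT M
}.

Definition xi_eq (R : realType) (M : mesh R) (D : model R)
    (V : {vspace bRT M}) (L : level M) (xi : bRT M) : Prop :=
  xi \in V /\ forall v, v \in V ->
    kinv_form D (sat L Wet) xi v
    = div_form (pcavg D (sat L Wet)) v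
      - bdry_form D (fun x => pbdry D NonWet x - pbdry D Wet x) v
      - grav_form D (dens D NonWet - dens D Wet) v.

Definition ut_eq (R : realType) (M : mesh R) (D : model R)
    (V : {vspace bRT M}) (L : level M) (xi : bRT M) (pw : Qh M) (u : bRT M) :
    Prop :=
  [/\ u \in V, in_QH pw,
      forall v, v \in V ->
        kinv_form D (sat L Wet) u v - div_form pw v
        = kinv_form D (sat L Wet)
            (cscale (fun K => frac D NonWet (sat L Wet K)) xi) v
          - bdry_form D (pbdry D Wet) v - grav_form D (dens D Wet) v &
      forall q, in_QH q ->
        beta D L Wet u q + beta D L NonWet u q
        = omega_int (fun K x => srct D L K x * q K)].

Definition srct_const (R : realType) (M : mesh R) (D : model R) (L : level M)
    (C : ccell M) : Prop :=
  exists c : R, forall K, coarse K = C ->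
    \forall x \ae leb2 R, cellset K x -> srct D L K x = c.

Definition postprocessed (R : realType) (M : mesh R) (D : model R)
    (L : level M) (u ut : bRT M) : Prop :=
  [/\ in_Vh ut,
      forall K, srct_const D L (coarse K) -> ut K = u K,
      forall K F, (if nbr K F is Some K' then coarse K' != coarse K else true) ->
        nflux ut K F = nflux u K F &
      forall q : Qh M,
        beta D L Wet ut q + beta D L NonWet ut q
        = omega_int (fun K x => srct D L K x * q K)].

Definition velpres_eq (R : realType) (M : mesh R) (D : model R)
    (V : {vspace bRT M}) (L : level M) (U : velpres M) : Prop :=
  [/\ xi_eq D V L (vp_xi U), ut_eq D V L (vp_xi U) (vp_pw U) (vp_ums U) &
      postprocessed D L (vp_ums U) (vp_ut U)].

Definition sat_eq (R : realType) (M : mesh R) (D : model R) (dt : R)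
    (L : level M) (U : velpres M) (S : Qh M) : Prop :=
  forall q : Qh M,
    omega_int (fun K _ => poro D * ((S K - sat L Wet K) / dt) * q K)
      + beta D L Wet (vp_ut U) q
    = omega_int (fun K x => srcf D L Wet K x * q K) + betac D L (vp_xi U) q.

(* u_w = f_w u_t - f_w f_n xi and u_n = f_n u_t + f_w f_n xi, with coefficients
   taken at the old saturation. *)
Definition phase_vel (R : realType) (M : mesh R) (D : model R) (L : level M)
    (U : velpres M) (a : phase) : bRT M :=
  let c := cscale (fun K => frac D Wet (sat L Wet K)
                            * frac D NonWet (sat L Wet K)) (vp_xi U) in
  let u := cscale (fun K => frac D a (sat L Wet K)) (vp_ut U) in
  if a is Wet then u - c else u + c.

(* Steps (1) and (2) of the scheme do not involve the time step.  [solve] is the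
   procedure, including the local postprocessing, by which they are carried out
   from the solution at the current level; their equations alone need not
   determine the velocities (the postprocessing, in particular, is not unique). *)
Definition scheme_step (R : realType) (M : mesh R) (D : model R)
    (V : {vspace bRT M}) (solve : level M -> velpres M) (dt : R)
    (L L' : level M) : Prop :=
  [/\ velpres_eq D V L (solve L),
      sat_eq D dt L (solve L) (sat L' Wet),
      forall K, sat L' NonWet K = 1 - sat L' Wet K &
      forall a, vel L' a = phase_vel D L (solve L) a].

(* [L 0], ..., [L n] are produced by the scheme at times [t 0 < ... < t n]
   from the initial level [L0]. *)
Definition scheme_run (R : realType) (M : mesh R) (D : model R)
    (V : {vspace bRT M}) (solve : level M -> velpres M) (L0 : level M)
    (n : nat) (t : nat -> R) (L : nat -> level M) : Prop :=
  [/\ L 0%N = L0,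
      forall K, sat L0 Wet K + sat L0 NonWet K = 1 &
      forall k, (k < n)%N ->
        t k < t k.+1 /\ scheme_step D V solve (t k.+1 - t k) (L k) (L k.+1)].

(* Main.v *)
Require Import Defs.
From mathcomp Require Import all_boot all_order all_algebra.
From mathcomp Require Import all_classical all_reals all_analysis.
From mathcomp Require Import ring lra.

Import Order.TTheory GRing.Theory Num.Theory.
Local Open Scope ring_scope.

(* Testing the saturation equation against the indicator of a fine cell [K]
   shows that the increment of [S_w] on [K] is [dt] times a rate which is
   determined by the solution at level [n] alone, since the velocities do not
   depend on the time step.  There are finitely many cells, so the rates are
   bounded, and a time step small enough keeps every increment below
   [min (S_tw, S_tn)], which bounds from below the distance of [S_w] to [0] and,
   because [S_w + S_n = 1], to [1]. *)

(** As a product of intervals, a cell gets its measurability and its area from the factors. *)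
Lemma cellsetE {R : realType} {M : mesh R} (K : cell M) :
  cellset K =
  (`[(corner M).1 + K.1%:R * hfine M, (corner M).1 + K.1.+1%:R * hfine M]
   `*` `[(corner M).2 + K.2%:R * hfine M, (corner M).2 + K.2.+1%:R * hfine M])%classic.
Proof.
apply/seteqP; split => [x xK|x [x1 x2] d] /=.
- by split => /=; rewrite in_itv /=; [exact: (xK 0)|exact: (xK 1)].
- rewrite /xcoord /cidx; move: x1 x2 => /=; rewrite !in_itv /=.
  by case: ifP.
Qed.

Lemma measurable_cellset {R : realType} {M : mesh R} (K : cell M) :
  measurable (cellset K : set (measurableTypeR R * measurableTypeR R)).
Proof. by rewrite cellsetE; apply: measurableX; exact: measurable_itv. Qed.

Lemma leb2_cellset {R : realType} {M : mesh R} (K : cell M) :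
  leb2 R (cellset K) = (hfine M ^+ 2)%:E.
Proof.
have h0 := hfine_gt0 M.
have side (c : R) (k : nat) :
    (@lebesgue_measure R) `[c + k%:R * hfine M, c + k.+1%:R * hfine M]%classic
    = (hfine M)%:E.
  rewrite lebesgue_measure_itv /= lte_fin -natr1 mulrDl mul1r addrA ltrDl h0.
  by rewrite -EFinD; congr EFin; ring.
rewrite cellsetE.
have muX := @product_measure1E _ _ (measurableTypeR R) (measurableTypeR R) R
  (@lebesgue_measure R) (@lebesgue_measure R).
apply: (etrans (muX _ _ _ _)); [exact: measurable_itv..|].
by rewrite expr2 EFinM; congr (_ * _)%E; exact: side.
Qed.

Lemma omega_int_cst {R : realType} {M : mesh R} (g : cell M -> R) :
  omega_int (fun K _ => g K) = hfine M ^+ 2 * \sum_K g K.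
Proof.
rewrite /omega_int mulr_sumr; apply: eq_bigr => K _.
rewrite Rintegral_cst; last exact: measurable_cellset.
by rewrite mulrC; congr (_ * _); exact: (congr1 fine (leb2_cellset K)).
Qed.

Definition indicator {R : realType} {M : mesh R} (K : cell M) : Qh M :=
  [ffun K' => (K' == K)%:R].

(** Here [poro D * hfine M ^+ 2] is the pore volume of the cell. Neither [dt] nor the new saturation
    occurs, so the time step can be chosen afterwards. *)
Definition sat_rate {R : realType} {M : mesh R} (D : model R) (L : level M)
    (U : velpres M) (K : cell M) : R :=
  let q := indicator K in
  (omega_int (fun K' x => srcf D L Wet K' x * q K')
   + betac D L (vp_xi U) q - beta D L Wet (vp_ut U) q)
  / (poro D * hfine M ^+ 2).

Lemma sat_eq_rate {R : realType} {M : mesh R} {D : model R} {dt : R}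
    {L : level M} {U : velpres M} {S : Qh M} (K : cell M) :
  0 < poro D -> 0 < dt -> sat_eq D dt L U S ->
  S K = sat L Wet K + dt * sat_rate D L U K.
Proof.
move=> z0 dt0 /(_ (indicator K)) /(canRL (addrK _)).
(* The accumulation term does not couple cells: the indicator leaves only the contribution of
   [K]. *)
rewrite omega_int_cst (bigD1 K) //= big1 => [|K' /negPf K'K]; last first.
  by rewrite ffunE K'K mulr0.
have h0 := hfine_gt0 M.
rewrite ffunE eqxx mulr1 addr0 /sat_rate => <-.
by field; rewrite !gt_eqF.
Qed.

Lemma scheme_run_sat_sum {R : realType} {M : mesh R} {D : model R}
    {V : {vspace bRT M}} {solve : level M -> velpres M} {L0 : level M}
    {n k : nat} {t : nat -> R} {L : nat -> level M} (K : cell M) :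
  scheme_run D V solve L0 n t L -> (k <= n)%N ->
  sat (L k) Wet K + sat (L k) NonWet K = 1.
Proof.
case=> L00 sum0 steps; case: k => [_|k kn]; first by rewrite L00.
by have [_ [_ _ -> _]] := steps k kn; rewrite addrC subrK.
Qed.

Theorem theorem4 (R : realType) (M : mesh R) (D : model R)
    (V : {vspace bRT M}) (solve : level M -> velpres M) (L0 : level M)
    (n : nat) (Ln : level M) (St : phase -> R) :
  admissible M D ->
  is_ms_space D (sat L0 Wet) V ->
  (forall a, 0 < St a) ->
  (forall a K, 0 < sat Ln a K < 1 /\ St a <= sat Ln a K) ->
  exists2 eps : R, 0 < eps &
    forall (t : nat -> R) (L : nat -> level M),
      scheme_run D V solve L0 n.+1 t L ->
      L n = Ln ->
      (t n.+1 - t n) / hfine M <= eps ->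
      forall a K, 0 < sat (L n.+1) a K < 1.
Proof.
move=> adm _ St0 Sn.
have h0 := hfine_gt0 M.
pose m := Num.min (St Wet) (St NonWet).
have m0 : 0 < m by rewrite lt_min !St0.
pose B := \sum_K `|sat_rate D Ln (solve Ln) K|.
have B0 : 0 <= B by exact: sumr_ge0.
have B10 : 0 < 1 + B by rewrite ltr_wpDr.
(* Up to the factor [hfine M], this says [dt <= m / (1 + B)]. The 1 covers [B = 0] and makes the
   bound on the increment strict. *)
exists (m / (1 + B) / hfine M); first by rewrite !divr_gt0.
move=> t L run LnE; rewrite ler_pM2r ?invr_gt0 // => dt_le.
have [_ _ /(_ n (ltnSn n)) [tn [_ Seq SN _]]] := run.
move: tn; rewrite -subr_gt0 => dt0.
set dt := t n.+1 - t n in dt_le dt0 Seq.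
suff SW K : 0 < sat (L n.+1) Wet K < 1.
  by case=> K //; rewrite SN; have := SW K; lra.
have := scheme_run_sat_sum K run (leqnSn n); rewrite LnE => sum1.
(* As [solve] is a function of the level, [L n = Ln] makes this rate one of those summed in [B],
   whatever the run. *)
rewrite (sat_eq_rate K (poro_gt0 adm) dt0 Seq) LnE.
set r := sat_rate _ _ _ _.
have rB : `|r| <= B by rewrite /B (bigD1 K) //= lerDl sumr_ge0.
have : `|dt * r| < m.
  rewrite normrM (gtr0_norm dt0).
  apply: (@le_lt_trans _ _ (m / (1 + B) * B)); first exact: ler_pM (ltW dt0) _ _ _.
  by rewrite mulrAC ltr_pdivrMr // ltr_pM2l // ltrDr.
have [_ SW] := Sn Wet K; have [_ SNW] := Sn NonWet K.
(* The bound by [St Wet] keeps the new value above 0; the bound by [St NonWet], with [sum1], keeps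
   it below 1. *)
by rewrite lt_min !ltr_norml; lra.
Qed.
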